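(* Let $(M,d)$ be a compact metric space and $f\colon M\to M$ a homeomorphism. Suppose that $f$ is an extension of an Anosov homeomorphism $f_R\colon M_R\to M_R$, where $R$ is an equivalence relation on $M$ compatible with $f$ and $M_R=M/R$, and let $q\colon M\to M_R$ be the canonical map. Then, given a neighborhood $\mathcal N_q$ of $q$ in $\mathcal C(M,M_R)$ there exists a neighborhood $\mathcal N_f$ of $f$ in $\mathcal H(M)$ such that for all $g\in\mathcal N_f$ there exists $q_g\in\mathcal N_q$ such that $f_R\circ q_g=q_g\circ g$. Moreover, there exists a neighborhood $\mathcal N_q^0$ of $q$ in $\mathcal C(M,M_R)$ such that if the given neighborhood $\mathcal N_q$ of $q$ in $\mathcal C(M,M_R)$ is chosen so that $\mathcal N_q\subseteq\mathcal N_q^0$ then the map $q_g$ is uniquely determined by $g\in\mathcal N_f$ (that is, $q_g$ is the only element of $\mathcal N_q$ satisfying $f_R\circ q_g=q_g\circ g$).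
   Context: An equivalence relation $R$ on $M$ (written $x\sim y$) is compatible with $f$ if for all $x,y\in M$: $x\sim y$ if and only if $f(x)\sim f(y)$. $M_R=M/R$ has the quotient topology, $q(x)=[x]$ is the canonical map, and $f_R\colon M_R\to M_R$, $f_R[x]=[f(x)]$, is the induced homeomorphism; $f$ is then called an extension of $f_R$. $\mathcal C(M,N)$ is the set of continuous maps $M\to N$ with the compact-open topology; for $M$ compact and $N$ metrizable with compatible metric $\rho$ it is induced by the metric $\max_{x\in M}\rho(g(x),h(x))$. $\mathcal H(M)$ is the subspace of $\mathcal C(M,M)$ consisting of homeomorphisms of $M$. For a homeomorphism $g$ of a compact metric space $(Y,\rho)$: $g$ is expansive if there is $\alpha>0$ such that $\rho(g^nx,g^ny)\le\alpha$ for all $n\in\mathbb Z$ implies $x=y$. $g$ has the shadowing property if for every $\varepsilon>0$ there is $\delta>0$ such that for every bi-sequence $(x_n)_{n\in\mathbb Z}$ in $Y$ with $\rho(gx_n,x_{n+1})<\delta$ for all $n\in\mathbb Z$ there is $x\in Y$ with $\rho(g^nx,x_n)<\varepsilon$ for all $n\in\mathbb Z$. $g$ is an Anosov homeomorphism if it is expansive and has the shadowing property. These properties do not depend on the compatible metric; saying that $f_R$ is Anosov includes that $M_R$ is metrizable. *)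

(* Defs.v *)
From HB Require Import structures.
From mathcomp Require Import all_boot all_order all_algebra.
From mathcomp Require Import all_classical all_reals all_analysis.

Set Implicit Arguments.
Unset Strict Implicit.
Unset Printing Implicit Defensive.

Import Order.TTheory GRing.Theory Num.Theory.

Local Open Scope classical_set_scope.
Local Open Scope ring_scope.

(* Gives continuousType X Y the compact-open topology. *)
Export ArrowAsCompactOpen.

Definition homeomorphism (X : topologicalType) (g : X -> X) : Prop :=
  continuous g /\
  exists h : X -> X, [/\ continuous h, cancel g h & cancel h g].

(* As a set of points of continuousType X X, it coerces to a type that carries
   the subspace topology. *)
Definition homeo_space (X : topologicalType) : set (continuousType X X) :=
  [set g | homeomorphism g].
Arguments homeo_space : clear implicits.

(* Meaningful for bijective g; then 'pinv_id setT g is the inverse of g. *)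
Definition iterz (X : Type) (g : X -> X) (n : int) : X -> X :=
  match n with
  | Posz k => iter k g
  | Negz k => iter k.+1 ('pinv_id setT g)
  end.

Definition compatible_metric (R : realType) (Y : topologicalType)
    (rho : Y -> Y -> R) : Prop :=
  [/\ forall x y, rho x y = 0 <-> x = y,
      forall x y, rho x y = rho y x,
      forall x y z, rho x z <= rho x y + rho y z
    & forall x : Y, nbhs x =
        filter_from [set eps : R | 0 < eps]
                    (fun eps => [set y | rho x y < eps])].

Definition expansive (R : realType) (Y : Type) (rho : Y -> Y -> R)
    (g : Y -> Y) : Prop :=
  exists2 alpha : R, 0 < alpha &
    forall x y, (forall n : int, rho (iterz g n x) (iterz g n y) <= alpha) ->
      x = y.

Definition shadowing (R : realType) (Y : Type) (rho : Y -> Y -> R)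
    (g : Y -> Y) : Prop :=
  forall eps : R, 0 < eps ->
  exists2 delta : R, 0 < delta &
    forall u : int -> Y, (forall n : int, rho (g (u n)) (u (n + 1)) < delta) ->
      exists x, forall n : int, rho (iterz g n x) (u n) < eps.

(* On a compact space the last two properties do not depend on the compatible
   metric, so it is enough to ask for one; this includes metrizability. *)
Definition anosov (R : realType) (Y : topologicalType) (g : Y -> Y) : Prop :=
  [/\ compact [set: Y], homeomorphism g
    & exists rho : Y -> Y -> R,
        [/\ compatible_metric rho, expansive rho g & shadowing rho g]].

(* equiv_rel is bool-valued, which classically is no restriction. *)
Definition compatible_rel (X : choiceType) (e : equiv_rel X) (f : X -> X) :
    Prop :=
  forall x y, e x y <-> e (f x) (f y).

Section Quotient.
Local Open Scope quotient_scope.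
Context {X : topologicalType}.
Implicit Types (e : equiv_rel X) (f : X -> X).

Definition quotient_space e : topologicalType := quotient_topology {eq_quot e}.

Definition qmap_fun e (x : X) : quotient_space e :=
  \pi_(quotient_topology {eq_quot e}) x.

Lemma qmap_continuous e : continuous (qmap_fun e).
Proof. exact: pi_continuous. Qed.

Definition qmap e : continuousType X (quotient_space e) :=
  mkcts (@qmap_continuous e).

Definition induced_map e f (c : quotient_space e) : quotient_space e :=
  qmap e (f (repr (c : quotient_topology {eq_quot e}))).

Lemma qmap_eq e x y : qmap e x = qmap e y <-> e x y.
Proof. by split=> /eqmodP. Qed.

Lemma qmap_surj e (c : quotient_space e) : exists x, c = qmap e x.
Proof.
exists (repr (c : quotient_topology {eq_quot e})).
exact: (esym (@reprK X (quotient_topology {eq_quot e}) c)).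
Qed.

Lemma induced_mapE e f x : compatible_rel e f ->
  induced_map f (qmap e x) = qmap e (f x).
Proof.
move=> ef; apply: (iffRL (qmap_eq e _ _)); apply: (iffLR (ef _ _)).
apply: (iffLR (qmap_eq e _ _)).
exact: (@reprK X (quotient_topology {eq_quot e})).
Qed.

Lemma induced_map_continuous e f : compatible_rel e f -> continuous f ->
  continuous (induced_map f : quotient_space e -> quotient_space e).
Proof.
move=> ef cf; apply/quotient_continuous.
have -> : induced_map f \o \pi_(quotient_topology {eq_quot e}) = qmap e \o f.
  by apply/funext => x; exact: induced_mapE.
by move=> x; apply: continuous_comp; [exact: cf|exact: qmap_continuous].
Qed.

Lemma induced_map_homeomorphism e f : compatible_rel e f ->
  homeomorphism f ->
  homeomorphism (induced_map f : quotient_space e -> quotient_space e).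
Proof.
move=> ef [cf [h [ch fh hf]]].
have eh : compatible_rel e h.
  by move=> x y; split=> [|/ef]; rewrite ?hf // => exy; apply/ef; rewrite !hf.
split; first exact: induced_map_continuous.
exists (induced_map h); split; first exact: induced_map_continuous.
- by move=> c; have [x ->] := qmap_surj c; rewrite !induced_mapE// fh.
- by move=> c; have [x ->] := qmap_surj c; rewrite !induced_mapE// hf.
Qed.

Lemma quotient_space_compact e :
  compact [set: X] -> compact [set: quotient_space e].
Proof.
move=> cX; have -> : [set: quotient_space e] = qmap e @` [set: X].
  by apply/seteqP; split=> // c _; have [x ->] := qmap_surj c; exists x.
by apply: continuous_compact => //; apply: continuous_subspaceT;
  exact: qmap_continuous.
Qed.

End Quotient.

Arguments induced_map {X} e f c.

(* Nq and Nf stand for the neighborhoods of the canonical map and of f. *)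
Definition semiconj_for (X : topologicalType) (f : homeo_space X)
    (e : equiv_rel X) (Nq : set (continuousType X (quotient_space e)))
    (Nf : set (homeo_space X)) : Prop :=
  forall g : homeo_space X, Nf g ->
    exists2 qg : continuousType X (quotient_space e), Nq qg &
      induced_map e (set_val f) \o qg = qg \o set_val g.

(* Main.v *)
(* If g is uniformly close to f, then for every x the bi-sequence q (g^n x) is a
   pseudo-orbit of f_R, because f_R (q y) = q (f y) is close to q (g y).  The
   point shadowing it, unique by expansivity, is q_g x.  Uniqueness gives
   f_R o q_g = q_g o g, since shifting the bi-sequence at x yields the one at
   g x.  The relation "y shadows the bi-sequence at x, with non-strict
   inequalities" is closed, so q_g has a closed graph in M x M_R, and is
   continuous since M_R is compact.  If two semiconjugacies are uniformly close,
   their values at x have f_R-orbits that stay close forever, hence agree. *)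
Require Import Defs.
From HB Require Import structures.
From mathcomp Require Import all_boot all_order all_algebra.
From mathcomp Require Import all_classical all_reals all_analysis.
From mathcomp Require Import lra.

Set Implicit Arguments.
Unset Strict Implicit.
Unset Printing Implicit Defensive.

Import Order.TTheory GRing.Theory Num.Theory.

Local Open Scope classical_set_scope.
Local Open Scope ring_scope.

Section iterz.
Context {X : topologicalType} (g : X -> X).
Hypothesis g_homeo : homeomorphism g.

Lemma homeomorphism_pinv :
  [/\ continuous ('pinv_id setT g), cancel g ('pinv_id setT g)
    & cancel ('pinv_id setT g) g].
Proof.
have [_ [h [ch gK hK]]] := g_homeo.
have pgK : cancel g ('pinv_id setT g).
  by move=> x; apply: pinvKV; rewrite ?inE// => y z _ _; exact: can_inj gK _ _.
have -> : 'pinv_id setT g = h by apply/funext => x; rewrite -{1}(hK x) pgK.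
by [].
Qed.

Lemma iterz_continuous n : continuous (iterz g n).
Proof.
have iter_continuous (k : X -> X) m : continuous k -> continuous (iter m k).
  move=> ck; elim: m => [|m IH] x /=; first exact: cvg_id.
  by apply: continuous_comp; [exact: IH|exact: ck].
case: n => n; apply: iter_continuous; first by case: g_homeo.
by case: homeomorphism_pinv.
Qed.

Lemma iterzSr n x : iterz g (n + 1) x = iterz g n (g x).
Proof.
have [_ gK pK] := homeomorphism_pinv.
(* [Negz 0] is -1, whose successor 0 leaves the negative branch of [iterz], so it is treated
   apart. *)
case: n => [n|[|n]]; first by rewrite -PoszD addn1 /= -iterSr.
  by rewrite /= gK.
have -> : Negz n.+1 + 1 = Negz n.
  by rewrite !NegzE -[n.+2]addn1 PoszD opprD addrNK.
by rewrite /iterz [RHS]iterSr gK.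
Qed.

Lemma iterz_comm n x : iterz g n (g x) = g (iterz g n x).
Proof.
have [_ gK pK] := homeomorphism_pinv.
case: n => n; first by rewrite /= -iterSr.
by rewrite /iterz iterSr gK /= pK.
Qed.

End iterz.

Lemma iterz_semiconj (X Y : topologicalType) (g : X -> X) (F : Y -> Y)
    (h : X -> Y) n x : homeomorphism g -> homeomorphism F ->
  F \o h = h \o g -> iterz F n (h x) = h (iterz g n x).
Proof.
move=> /homeomorphism_pinv[_ _ gK] /homeomorphism_pinv[_ FK _] Fh.
have FhE y : F (h y) = h (g y) by exact: (congr1 (fun k => k y) Fh).
case: n => n; rewrite /iterz.
  by elim: n => //= n ->.
elim: n.+1 => //= m ->.
(* Writing the argument of [h] as [g] of its preimage lets [F] come out and cancel against its
   inverse. *)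
by rewrite -{1}(gK (iter m _ x)) -FhE FK.
Qed.

(** The cluster hypothesis says that the graph of [h] is closed. By compactness of [Y], a filter
    whose only cluster point is [h x] converges to it. *)
Lemma cluster_continuous (X Y : topologicalType) (h : X -> Y) :
  compact [set: Y] -> hausdorff_space Y ->
  (forall x z, cluster (h @ x) z -> z = h x) -> continuous h.
Proof.
move=> cY hY hcl x; apply: (compact_cluster_set1 hY cY); [exact: filterT..|].
apply/seteqP; split => z /=; first exact: hcl.
move=> -> A B /nbhs_singleton Ax /nbhs_singleton Bx.
by exists (h x).
Qed.

Section compatible_metric.
Context {R : realType} {Y : topologicalType} {rho : Y -> Y -> R}.
Hypothesis rho_metric : compatible_metric rho.

Lemma compatible_metric_refl x : rho x x = 0.
Proof. by case: rho_metric => rho0 _ _ _; apply/rho0. Qed.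

Lemma nbhs_compatible_metric y eps : 0 < eps -> nbhs y [set z | rho y z < eps].
Proof. by case: rho_metric => _ _ _ -> eps0; exists eps. Qed.

Lemma compatible_metric_hausdorff : hausdorff_space Y.
Proof.
have [rho0 rhoC rhoD _] := rho_metric.
move=> x y xy; apply/rho0/eqP; rewrite eq_le; apply/andP; split; last first.
  (* Nonnegativity comes from the triangle inequality along x, y, x. *)
  by have := rhoD x y x; rewrite compatible_metric_refl (rhoC y x); lra.
apply/ler_addgt0Pl => eps eps0; rewrite addr0.
have e2 : 0 < eps / 2 by lra.
have [z [xz yz]] := xy _ _ (nbhs_compatible_metric x e2) (nbhs_compatible_metric y e2).
by have := rhoD x z y; rewrite /= in xz yz; rewrite (rhoC z y); lra.
Qed.

(** Evaluation is jointly continuous over a locally compact Hausdorff [X], which gives the bound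
    near each point; compactness of [X] makes it uniform. The extra map [q] allows a target [Z]
    without a metric, such as [M] seen through the canonical map. *)
Lemma near_eval_metric (X Z : topologicalType) (q : Z -> Y)
    (u : continuousType X Z) eps :
  compact [set: X] -> hausdorff_space X -> continuous q -> 0 < eps ->
  \forall v \near u, forall x,
    rho (q (u x)) (q ((v : continuousType X Z) x)) < eps.
Proof.
have [_ rhoC rhoD _] := rho_metric.
move=> cX hX cq eps0.
have lX : locally_compact [set: X].
  move=> x _; exists setT; rewrite ?withinET; first exact: filterT.
  by split => //; exact: closedT.
have cev : continuous (uncurry (fun v : continuousType X Z => v : X -> Z)).
  apply: continuous_uncurry => //; last by move=> v; exact: cts_fun.
  exact: initial_continuous.
have /compact_near_coveringP/(_ _ (nbhs u)
  (fun v x => rho (q (u x)) (q (v x)) < eps) (nbhs_filter u)) near_cX := cX.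
apply: filterS (near_cX _) => [v vP x|x _]; first exact: vP.
have e2 : 0 < eps / 2 by lra.
have near_qux := nbhs_compatible_metric (q (u x)) e2.
have cqe : continuous (q \o uncurry (fun v : continuousType X Z => v : X -> Z)).
  by move=> p; apply: continuous_comp; [exact: cev|exact: cq].
have [[P Q] [/= uP xQ] PQ] := cqe (u, x) _ near_qux.
have cqu : continuous (q \o u).
  by move=> y; apply: continuous_comp; [exact: cts_fun|exact: cq].
(* For y in this set both [q (u y)] and [q (v y)] lie within [eps / 2] of [q (u x)]. *)
exists (Q `&` (q \o u) @^-1` [set z | rho (q (u x)) z < eps / 2], P).
  by split => //=; apply: filterI => //; exact: cqu.
move=> [y v] /= [[Qy uy] Pv].
have vy : rho (q (u x)) (q (v y)) < eps / 2 := PQ (v, y) (conj Pv Qy).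
have := rhoD (q (u y)) (q (u x)) (q (v y)).
by rewrite (rhoC (q (u y)) (q (u x))); lra.
Qed.

(** Uniform convergence implies convergence in the compact-open topology: the filter [F] of uniform
    neighborhoods of [q] converges to [q]. *)
Lemma nbhs_continuousType_metric (X : topologicalType)
    (q : continuousType X Y) (N : set (continuousType X Y)) :
  nbhs q N -> exists2 eps : R, 0 < eps &
    forall h : continuousType X Y, (forall x, rho (q x) (h x) < eps) -> N h.
Proof.
have [_ _ rhoD _] := rho_metric.
case=> /= _ [[W oW <-] Wq] WN.
pose F : set_system {compact-open, X -> Y} := filter_from [set eps : R | 0 < eps]
  (fun eps => [set h | forall x, rho (q x) (h x) < eps]).
have FF : Filter F.
  apply: filter_from_filter; first by exists 1 => /=.
  move=> a b /= a0 b0; exists (Num.min a b); first by rewrite /= lt_min a0.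
  by move=> h /= hab; split => x; have := hab x; rewrite lt_min => /andP[].
have Fq : F --> (q : {compact-open, X -> Y}).
  apply/compact_open_cvgP => K O cK oO qKO.
  have /compact_near_coveringP/(_ _ ((0 : R)^'+)
    (fun eps x => forall z, rho (q x) z < eps -> O z)) := cK.
  case=> [x Kx|eps' eps'0 eps'KO].
    have : nbhs (q x) O.
      by apply: open_nbhs_nbhs; split => //; apply: qKO; exists x.
    case: rho_metric => _ _ _ -> [eps /= eps0 epsO].
    have e2 : 0 < eps / 2 by lra.
    exists (q @^-1` [set z | rho (q x) z < eps / 2], [set d | d < eps / 2]) => /=.
      split; first by apply: (@cts_fun _ _ q); exact: nbhs_compatible_metric.
      exact: nbhs_right_lt.
    move=> [y d] /= [qy de] z yz; apply: epsO => /=.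
    by have := rhoD (q x) (q y) z; lra.
  have [d /= d0 dKO] : exists2 d : R, 0 < d &
      forall x, K x -> forall z, rho (q x) z < d -> O z.
    exists (eps' / 2) => /=; first by rewrite divr_gt0.
    apply: eps'KO => /=; last by rewrite divr_gt0.
    rewrite sub0r normrN gtr0_norm ?divr_gt0// ltr_pdivrMr//.
    by rewrite /= in eps'0; lra.
  by exists d => // h /= hd _ [x Kx <-]; exact: dKO (hd x).
have /Fq[eps eps0 epsW] : nbhs (q : {compact-open, X -> Y}) W.
  by apply: open_nbhs_nbhs; split.
by exists eps => // h hq; apply: WN; apply: epsW.
Qed.

Lemma semiconj_unique (X : topologicalType) (F : Y -> Y) (g : X -> X)
    (alpha : R) (h k : X -> Y) :
  homeomorphism F -> homeomorphism g ->
  (forall y z, (forall n, rho (iterz F n y) (iterz F n z) <= alpha) -> y = z) ->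
  F \o h = h \o g -> F \o k = k \o g ->
  (forall x, rho (h x) (k x) <= alpha) -> h = k.
Proof.
move=> hF hg exF Fh Fk hk; apply/funext => x; apply: exF => n.
by rewrite !(iterz_semiconj _ _ hg hF).
Qed.

(** [delta] comes from shadowing for [F] alone, hence before [q] and [g]; the map [h] sends x to the
    point shadowing [q (iterz g n x)]. *)
Lemma approx_semiconj_shadowed (F : Y -> Y) (eps : R) :
  compact [set: Y] -> homeomorphism F -> expansive rho F -> shadowing rho F ->
  0 < eps ->
  exists2 delta : R, 0 < delta &
    forall (X : topologicalType) (q : X -> Y) (g : X -> X),
      continuous q -> homeomorphism g ->
      (forall x, rho (F (q x)) (q (g x)) < delta) ->
      exists h : X -> Y,
        [/\ continuous h, F \o h = h \o g & forall x, rho (q x) (h x) < eps].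
Proof.
have [_ rhoC rhoD _] := rho_metric.
move=> cY hF [alpha alpha0 exF] shF eps0.
(* The bound [eps] keeps [h] close to [q]; with [alpha / 2], two points shadowing the same
   bi-sequence have [alpha]-close orbits and so coincide. *)
pose eta := Num.min eps (alpha / 2).
have eta0 : 0 < eta by rewrite lt_min eps0 divr_gt0.
have etaeps : eta <= eps by rewrite ge_min lexx.
have etaalpha : eta <= alpha / 2 by rewrite ge_min lexx orbT.
have [delta delta0 shd] := shF _ eta0.
exists delta => // X q g cq hg qg.
have shadow x : exists y, forall n, rho (iterz F n y) (q (iterz g n x)) < eta.
  by apply: (shd (fun n => q (iterz g n x))) => n; rewrite iterzSr// iterz_comm.
have [h hP] := choice shadow.
(* The non-strict inequality survives limits, so this also applies to cluster points of [h]. *)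
have hE x y : (forall n, rho (iterz F n y) (q (iterz g n x)) <= eta) -> y = h x.
  move=> yP; apply: exF => n.
  have := rhoD (iterz F n y) (q (iterz g n x)) (iterz F n (h x)).
  by have := hP x n; have := yP n; rewrite (rhoC (q _)); lra.
exists h; split; last first.
- by move=> x; have := hP x 0; rewrite /= rhoC; lra.
- apply/funext => x /=; apply: hE => n; apply: ltW.
  by rewrite -!iterzSr.
apply: cluster_continuous => //; first exact: compatible_metric_hausdorff.
move=> x z hz; apply: hE => n; rewrite leNgt; apply/negP => gap.
pose c := (rho (iterz F n z) (q (iterz g n x)) - eta) / 2.
have c0 : 0 < c by rewrite /c; lra.
have near_z := iterz_continuous hF (nbhs_compatible_metric (iterz F n z) c0).
have cqg : continuous (q \o iterz g n).
  by move=> y; apply: continuous_comp; [exact: iterz_continuous|exact: cq].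
have near_x := cqg x _ (nbhs_compatible_metric (q (iterz g n x)) c0).
have hnear_x : (h @ x) (h @` ((q \o iterz g n) @^-1`
    [set y | rho (q (iterz g n x)) y < c])).
  by apply: (@filterS _ (nbhs x) _ _ _ _ near_x) => y yx; exists y.
have [_ [[y /= yx <-] /= yz]] := hz _ _ hnear_x near_z.
have := rhoD (iterz F n z) (iterz F n (h y)) (q (iterz g n x)).
have := rhoD (iterz F n (h y)) (q (iterz g n y)) (q (iterz g n x)).
have := hP y n; rewrite (rhoC (q (iterz g n y)) (q (iterz g n x))).
by move: yx yz; rewrite /c; lra.
Qed.

End compatible_metric.

Theorem theorem4p9 (R : realType) (M : metricType R)
    (f : homeo_space M) (e : equiv_rel M) :
  compact [set: M] ->
  compatible_rel e (set_val f) ->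
  anosov R (induced_map e (set_val f)) ->
  (forall Nq : set (continuousType M (quotient_space e)), nbhs (qmap e) Nq ->
     exists2 Nf : set (homeo_space M), nbhs f Nf & semiconj_for f Nq Nf) /\
  (exists2 Nq0 : set (continuousType M (quotient_space e)),
     nbhs (qmap e) Nq0 &
     forall Nq : set (continuousType M (quotient_space e)),
       nbhs (qmap e) Nq -> Nq `<=` Nq0 ->
     forall Nf : set (homeo_space M), nbhs f Nf -> semiconj_for f Nq Nf ->
     forall g : homeo_space M, Nf g ->
       exists! qg : continuousType M (quotient_space e),
         Nq qg /\ induced_map e (set_val f) \o qg = qg \o set_val g).
Proof.
move=> cM ef [cY hF [rho [rho_metric exF shF]]].
have [_ rhoC rhoD _] := rho_metric.
have hM : hausdorff_space M by exact: metric_hausdorff.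
have homeoP (g : homeo_space M) : homeomorphism (set_val g).
  exact: set_mem (valP g).
split=> [Nq /(nbhs_continuousType_metric rho_metric)[eps eps0 epsNq]|].
  have [delta delta0 shadow] :=
    approx_semiconj_shadowed rho_metric cY hF exF shF eps0.
  have near_f := near_eval_metric rho_metric (set_val f) cM hM
    (@qmap_continuous _ e) delta0.
  exists (set_val @^-1` [set g : continuousType M M |
      forall x, rho (qmap e (set_val f x)) (qmap e (g x)) < delta]).
    exact: (@initial_continuous _ _ set_val f _ near_f).
  move=> g /= gf.
  (* [induced_mapE] identifies [F (q x)] with [q (f x)], so closeness of [g] to [f] is the
     pseudo-orbit bound. *)
  have [h [ch Fh hq]] := shadow M (qmap e) (set_val g) (@qmap_continuous _ e)
    (homeoP g) (fun x => eq_ind_r (fun y => rho y _ < _) (gf x)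
      (induced_mapE x ef)).
  by exists (mkcts ch) => //; exact: epsNq.
have [alpha alpha0 exaF] := exF.
(* Two maps within [alpha / 2] of the canonical map are within [alpha] of each other, as expansivity
   requires. *)
have a2 : 0 < alpha / 2 by lra.
exists [set h : continuousType M (quotient_space e) |
    forall x, rho (qmap e x) (h x) < alpha / 2].
  exact: (near_eval_metric rho_metric (qmap e) cM hM (fun=> cvg_id) a2).
move=> Nq _ Nq0 Nf _ sNf g /sNf[qg Nqg Fqg]; exists qg; split=> // k [Nk Fk].
suff qgk : (qg : M -> _) = k.
  by apply/continuousEP => x; exact: (congr1 (fun h => h x) qgk).
apply: (semiconj_unique hF (homeoP g) exaF Fqg Fk) => x.
have := rhoD (qg x) (qmap e x) (k x); rewrite (rhoC (qg x) (qmap e x)).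
by have := Nq0 _ Nqg x; have := Nq0 _ Nk x => /=; lra.
Qed.
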